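(* Let $N\ge1$ be an integer, $0\le\gamma\le\mu<N$, and let $q_1\in(1,\infty]$ and $q_2\in(1,\infty]$ satisfy $$0\le\frac1{q_2}<\frac{\mu-\gamma}N+\frac1{q_1}\le\frac\mu N+\frac1{q_1}<1 .$$ Then there exists a constant $C>0$ depending on $N,\gamma,\mu,q_1$ and $q_2$ such that $$\left\||\cdot|^\gamma e^{t\Delta}u\right\|_{q_2}\ \le\ C\,t^{-\frac N2\left(\frac1{q_1}-\frac1{q_2}\right)-\frac{\mu-\gamma}2}\left\||\cdot|^\mu u\right\|_{q_1}$$ for all $t>0$ and all $u$ with $|\cdot|^\mu u\in L^{q_1}(\mathbb R^N)$.
   Context: $e^{t\Delta}$ is the heat semigroup on $\mathbb R^N$ (convolution with $G_t(x)=(4\pi t)^{-N/2}e^{-|x|^2/4t}$), $\|\cdot\|_p$ is the norm of $L^p(\mathbb R^N)$, and $1/\infty=0$. *)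

(* Defs.v *)
From HB Require Import structures.
From mathcomp Require Import all_boot all_order all_algebra.
From mathcomp Require Import all_classical all_reals all_analysis.

Set Implicit Arguments.
Unset Strict Implicit.
Unset Printing Implicit Defensive.
Import Order.TTheory GRing.Theory Num.Theory.
Import numFieldNormedType.Exports.

Local Open Scope classical_set_scope.
Local Open Scope ring_scope.

(* R^N is the type of N-tuples of reals, which the library equips with the
   product of the Borel sigma-algebras. *)
Notation euclid R N := (N.-tuple (measurableTypeR R)).

Section product_with_line.
Context (R : realType) (n : nat).
Variable m : {sigma_finite_measure set (euclid R n) -> \bar R}.

Definition tcons (z : measurableTypeR R * euclid R n) : euclid R n.+1 :=
  [tuple of z.1 :: z.2].

Lemma measurable_tcons : measurable_fun [set: _] tcons.
Proof. exact: measurable_cons. Qed.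

(* The product of the Lebesgue measure of R and of a measure m on R^n,
   transported from R * R^n to R^(n+1). *)
Definition line_product : set (euclid R n.+1) -> \bar R :=
  pushforward (lebesgue_measure \x m)%E tcons.

Let line_product0 : line_product set0 = 0%E.
Proof. by rewrite /line_product /pushforward preimage_set0 measure0. Qed.

Let line_product_ge0 A : (0 <= line_product A)%E.
Proof. by rewrite /line_product /pushforward; exact: measure_ge0. Qed.

Let measurable_preimage A : measurable A -> measurable (tcons @^-1` A).
Proof. by move=> mA; rewrite -[X in measurable X]setTI; exact: measurable_tcons. Qed.

Let line_product_sigma_additive : semi_sigma_additive line_product.
Proof.
move=> F mF tF mUF; rewrite /line_product /pushforward preimage_bigcup.
apply: measure_semi_sigma_additive.
- by move=> k; exact: measurable_preimage.
- apply/trivIsetP => /= i j _ _ ij; rewrite -preimage_setI.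
  by move/trivIsetP : tF => /(_ _ _ _ _ ij) ->//; rewrite preimage_set0.
- by rewrite -preimage_bigcup; exact: measurable_preimage.
Qed.

HB.instance Definition _ := isMeasure.Build _ _ _
  line_product line_product0 line_product_ge0 line_product_sigma_additive.

Let line_product_sigma_finite : sigma_finite setT line_product.
Proof.
pose g (x : euclid R n.+1) : measurableTypeR R * euclid R n :=
  (thead x, [tuple of behead x]).
have gK : cancel tcons g.
  by move=> [a b]; rewrite /g /tcons /= theadE; congr pair; exact: val_inj.
have mg : measurable_fun setT g.
  apply/measurable_fun_pairP; split; last exact: measurable_behead.
  exact: measurable_tnth.
have /sigma_finiteP[F [FT ndF Foo]] := sigma_finiteT (@lebesgue_measure R).
have /sigma_finiteP[G [GT ndG Goo]] := sigma_finiteT m.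
exists (fun k => g @^-1` (F k `*` G k)).
  apply/esym; rewrite -subTset => x _.
  have [i _ Fi] : (\bigcup_k F k) (g x).1 by rewrite -FT.
  have [j _ Gj] : (\bigcup_k G k) (g x).2 by rewrite -GT.
  exists (maxn i j) => //; split.
  - by apply: (subsetPset _ _ (ndF _ _ (leq_maxl i j))).
  - by apply: (subsetPset _ _ (ndG _ _ (leq_maxr i j))).
move=> k; have [mF Foo'] := Foo k; have [mG Goo'] := Goo k; split.
  by rewrite -[X in measurable X]setTI; apply: mg => //; exact: measurableX.
rewrite /line_product /pushforward -comp_preimage.
rewrite (_ : g \o tcons = id); last by apply/funext => z /=; rewrite gK.
by rewrite product_measure1E// lte_mul_pinfty// ge0_fin_numE.
Qed.

HB.instance Definition _ := @Measure_isSigmaFinite.Build _ _ _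
  line_product line_product_sigma_finite.

End product_with_line.

(* N-dimensional Lebesgue measure, as an iterated product measure; R^0 carries
   the unit mass at its only point. *)
Fixpoint lebesgueN (R : realType) (N : nat) :
    {sigma_finite_measure set (euclid R N) -> \bar R} :=
  if N is n.+1 then line_product (lebesgueN R n)
  else dirac ([tuple] : euclid R 0).

Lemma lebesgueN_box (R : realType) (N : nat)
    (A : 'I_N -> set (measurableTypeR R)) :
  (forall i, measurable (A i)) ->
  lebesgueN R N [set x | forall i, A i (tnth x i)] =
  (\prod_(i < N) lebesgue_measure (A i))%E.
Proof.
elim: N A => [|n IH] A mA.
  rewrite big_ord0 /= diracE mem_set// => -[]//.
rewrite big_ord_recl -(IH (fun i => A (lift ord0 i)))//=.
rewrite /line_product /pushforward -product_measure1E//.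
  congr (product_measure1 _ _ _); apply/seteqP; split => [[a b]/= Aab|[a b]/= [Aa Ab]].
    split; first by have := Aab ord0.
    by move=> i; have := Aab (lift ord0 i); rewrite tnthS.
  move=> i; case: (unliftP ord0 i) => [j ->|->//].
  by rewrite tnthS; exact: Ab.
rewrite (_ : mkset _ = \bigcap_(i in [set: 'I_n])
    ((fun x : euclid R n => tnth x i) @^-1` A (lift ord0 i))).
  apply: fin_bigcap_measurable => [|i _]; first exact: finite_finset.
  rewrite -[X in measurable X]setTI.
  by apply: measurable_tnth => //; exact: mA.
by apply/seteqP; split => [x Ax i _|x Ax i]; [exact: Ax|exact: Ax].
Qed.

Section heat.
Context (R : realType) (N : nat).
Implicit Types (x y : euclid R N) (t : R) (u : euclid R N -> R).

Definition enorm x : R := Num.sqrt (\sum_(i < N) tnth x i ^+ 2).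

Definition esub x y : euclid R N := [tuple tnth x i - tnth y i | i < N].

Definition heat_kernel t x : R :=
  (4 * pi * t) `^ (- (N%:R / 2)) * expR (- (enorm x ^+ 2 / (4 * t))).

(* The value is an extended real, so that no convergence of the convolution
   integral is built in: a divergent integral has infinite value. *)
Definition heat_semigroup t u x : \bar R :=
  (\int[lebesgueN R N]_y (heat_kernel t (esub x y) * u y)%:E)%E.

End heat.

(* 1 / q for an extended real exponent q > 1, with 1 / +oo = 0. *)
Definition inv_exponent (R : realType) (q : \bar R) : R := fine (q^-1)%E.

Lemma inv_exponent_fin (R : realType) (r : R) :
  r != 0 -> inv_exponent r%:E = r^-1.
Proof. by move=> r0; rewrite /inv_exponent inver (negbTE r0). Qed.

Lemma inv_exponent_pinfty (R : realType) : inv_exponent (+oo%E : \bar R) = 0.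
Proof. by rewrite /inv_exponent invey. Qed.

(* Main.v *)
Require Import Defs.
From mathcomp Require Import all_boot all_order all_algebra.
From mathcomp Require Import all_classical all_reals all_analysis.
From mathcomp Require Import measurable_realfun ess_sup_inf hoelder.
From mathcomp Require Import ring lra.

(* Put rho = sqrt t and f = |.|^mu |u|. From |x|^gamma <= C (|x - y|^gamma +
   |y|^gamma) and the Gaussian decay of the kernel,
     |x|^gamma |e^{t Delta} u|(x) <= C rho^(- N - (mu - gamma)) *
       int Phi(x - y) (n(y) + m(y)) f(y) dy,
   where Phi(z) = max(1, |z|/rho)^(- (N + 1)), the near weight
   n(y) = (|y|/rho)^(- mu) is restricted to |y| <= rho, and the far weight is
   m(y) = max(1, |y|/rho)^(- (mu - gamma)). As 0 <= Phi <= 1 has integral of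
   order rho^N, Young's inequality maps L^r to L^q2 whenever r <= q2. Hoelder's
   inequality puts n f in L^1, because mu < N (1 - 1/q1), and m f in L^r with
   1/r = max(1/q1, 1/q2), because 1/q2 - 1/q1 < (mu - gamma)/N. Both terms are
   O(rho^(N (1 + 1/q2 - 1/q1))) times the norm of f. The integrals of powers
   of |y| are compared with sums over dyadic cubes. *)

Import Order.TTheory GRing.Theory Num.Theory.
Import numFieldNormedType.Exports.

Local Open Scope classical_set_scope.
Local Open Scope ring_scope.

Set Implicit Arguments.
Unset Strict Implicit.
Unset Printing Implicit Defensive.

(** * Hoelder and Young inequalities *)

(** Raising to the power [r] is monotone and invertible on nonnegative extended reals. Bounds with a
    finite exponent are thereby proved on the integral itself, free of roots. *)
Lemma Lnorm_le_EFin {d} {T : measurableType d} {R : realType}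
    (m : {measure set T -> \bar R}) (r M : R) (h : T -> \bar R) :
  0 < r -> 0 <= M ->
  (('N[m]_(r%:E) [h] <= M%:E) <->
   (\int[m]_x (`|h x| `^ r) <= (M `^ r)%:E))%E.
Proof.
move=> r0 M0; rewrite -poweR_Lnorm ?gt_eqF//; split=> [hM|].
  rewrite -poweR_EFin; apply: gt0_ler_poweR => //; first exact: ltW.
  - by rewrite in_itv/= leey Lnorm_ge0.
  - by rewrite in_itv/= leey lee_fin M0.
rewrite -[X in (_ <= X)%E -> _]poweR_EFin.
have r'0 : 0 <= r^-1 by rewrite invr_ge0 ltW.
move=> /(gt0_ler_poweR r'0); rewrite -!poweRrM mulfV ?gt_eqF// !poweRe1 ?lee_fin//.
  by apply; rewrite in_itv/= leey ?poweR_ge0 ?lee_fin ?powR_ge0.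
exact: Lnorm_ge0.
Qed.

Lemma Lnorm_le_pinfty {d} {T : measurableType d} {R : realType}
    (m : {measure set T -> \bar R}) (M : R) (h : T -> \bar R) :
  0 <= M ->
  ('N[m]_(+oo) [h] <= M%:E)%E <-> {ae m, forall x, (`|h x| <= M%:E)%E}.
Proof.
move=> M0; rewrite unlock /Lnorm.
have [mT|mT] := ltP 0%E (m [set: T]).
  by split=> [/ess_supP//|?]; apply/ess_supP.
(* On a space of total mass zero the norm is 0 by definition, and every property holds almost
   everywhere. *)
split=> // _; exists setT; split => //.
by apply/eqP; rewrite eq_le measure_ge0 mT.
Qed.

Lemma inv_exponent_ge0 {R : realType} (q : \bar R) :
  (0 <= q)%E -> 0 <= inv_exponent q.
Proof. by move=> q0; rewrite /inv_exponent fine_ge0// inve_ge0. Qed.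

Section weighted_hoelder.
Context {d} {T : measurableType d} {R : realType}.
Variable m : {measure set T -> \bar R}.

(** Hölder's inequality with exponents [r / (r - 1)] and [r] for the splitting of [k g] into
    [k^(1 - 1/r)] and [k^(1/r) g]; the first factor has norm at most [A^(1 - 1/r)]. For [r = 1] the
    two sides coincide. *)
Lemma jensen_weight (k g : T -> R) (A r : R) :
  measurable_fun setT k -> measurable_fun setT g ->
  (forall y, 0 <= k y) -> (forall y, 0 <= g y) -> 0 <= A -> 1 <= r ->
  (\int[m]_y (k y)%:E <= A%:E ->
   (\int[m]_y (k y * g y)%:E) `^ r <=
     (A `^ (r - 1))%:E * \int[m]_y (k y * g y `^ r)%:E)%E.
Proof.
move=> mk mg k0 g0 A0; rewrite le_eqVlt => /predU1P[<-|r1] kA.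
  rewrite subrr powRr0 mul1e poweRe1; last first.
    by apply: integral_ge0 => y _; rewrite lee_fin mulr_ge0.
  by under [leRHS]eq_integral do rewrite powRr1//.
have r0 : 0 < r by rewrite (lt_trans _ r1).
pose s := r / (r - 1).
have s0 : 0 < s by rewrite divr_gt0// subr_gt0.
have sV : s^-1 = 1 - r^-1.
  by rewrite invf_div mulrBl mulfV ?gt_eqF// mul1r.
pose f1 y := k y `^ s^-1.
pose f2 y := k y `^ r^-1 * g y.
have mf1 : measurable_fun setT f1 by exact: (measurableT_comp (measurable_powR _)).
have mf2 : measurable_fun setT f2.
  by apply: measurable_funM => //; exact: (measurableT_comp (measurable_powR _)).
have := hoelder m mf1 mf2 s0 r0; rewrite sV subrK => /(_ erefl).
rewrite Lnorm1.
have -> : (\int[m]_y `|(EFin \o (f1 \* f2)%R) y| = \int[m]_y (k y * g y)%:E)%E.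
  apply: eq_integral => y _ /=; rewrite /f1 /f2 mulrA -powRD sV.
    by rewrite subrK powRr1// ger0_norm// mulr_ge0.
  by rewrite subrK oner_eq0.
have N1 : ('N[m]_s%:E [EFin \o f1] <= (A `^ s^-1)%:E)%E.
  apply/Lnorm_le_EFin => //; first exact: powR_ge0.
  rewrite -powRrM mulVf ?gt_eqF// powRr1//.
  apply: le_trans kA; rewrite le_eqVlt; apply/orP; left; apply/eqP.
  apply: eq_integral => y _ /=; rewrite /f1 ger0_norm ?powR_ge0//.
  by rewrite -powRrM mulVf ?gt_eqF// powRr1.
have N2 : ('N[m]_r%:E [EFin \o f2] `^ r = \int[m]_y (k y * g y `^ r)%:E)%E.
  rewrite poweR_Lnorm ?gt_eqF//; apply: eq_integral => y _ /=.
  rewrite /f2 ger0_norm ?mulr_ge0 ?powR_ge0// powRM ?powR_ge0//.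
  by rewrite -powRrM mulVf ?gt_eqF// powRr1.
move=> H.
have {}H : (\int[m]_y (k y * g y)%:E <= (A `^ s^-1)%:E * 'N[m]_r%:E [EFin \o f2])%E.
  exact: le_trans H (lee_wpmul2r (Lnorm_ge0 _ _ _) N1).
have := gt0_ler_poweR (ltW r0) _ _ H.
rewrite poweRM ?Lnorm_ge0 ?lee_fin ?powR_ge0// N2 poweR_EFin -powRrM sV.
rewrite mulrBl mul1r mulVf ?gt_eqF//; apply.
- rewrite in_itv/= leey andbT; apply: integral_ge0 => y _.
  by rewrite lee_fin mulr_ge0.
- by rewrite in_itv/= leey andbT mule_ge0 ?Lnorm_ge0 ?lee_fin ?powR_ge0.
Qed.

(** Hölder's inequality for [w^r] and [g^r] with exponents [s / r] and [q / r], conjugate because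
    [r / s + r / q = 1]. For [q = +oo] the relation forces [r = s], and [g] is replaced by its
    almost everywhere bound [M]. *)
Lemma Lnorm_weight_le (w g : T -> R) (s r : R) (q : \bar R) (B M : R) :
  measurable_fun setT w -> measurable_fun setT g ->
  (forall y, 0 <= w y) -> (forall y, 0 <= g y) ->
  0 < s -> 0 < r -> (0 < q)%E -> r^-1 = s^-1 + inv_exponent q ->
  0 <= B -> 0 <= M ->
  (\int[m]_y (w y `^ s)%:E <= B%:E)%E ->
  ('N[m]_q [EFin \o g] <= M%:E)%E ->
  ('N[m]_r%:E [EFin \o (w \* g)%R] <= (B `^ s^-1 * M)%:E)%E.
Proof.
move=> mw mg w0 g0 s0 r0 + + B0 M0 wB gM.
have powRVK (a : R) : 0 < a -> forall x : R, 0 <= x -> (x `^ a^-1) `^ a = x.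
  by move=> a0 x x0; rewrite -powRrM mulVf ?gt_eqF// powRr1.
case: q gM => [q gM|gM _|//].
  rewrite lte_fin => q0; rewrite inv_exponent_fin ?gt_eqF// => rsq.
  apply/Lnorm_le_EFin => //; first by rewrite mulr_ge0// powR_ge0.
  pose f1 y := w y `^ r. pose f2 y := g y `^ r.
  have mf1 : measurable_fun setT f1 by exact: (measurableT_comp (measurable_powR _)).
  have mf2 : measurable_fun setT f2 by exact: (measurableT_comp (measurable_powR _)).
  have sr0 : 0 < s / r by exact: divr_gt0.
  have qr0 : 0 < q / r by exact: divr_gt0.
  have := hoelder m mf1 mf2 sr0 qr0; rewrite !invf_div -mulrDr -rsq mulfV ?gt_eqF//.
  move=> /(_ erefl); rewrite Lnorm1.
  have -> : (\int[m]_y `|(EFin \o (f1 \* f2)%R) y|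
           = \int[m]_y (`|(EFin \o (w \* g)%R) y| `^ r))%E.
    apply: eq_integral => y _ /=; rewrite ger0_norm ?mulr_ge0 ?powR_ge0//.
    by rewrite ger0_norm ?mulr_ge0// powRM.
  move=> /le_trans; apply.
  rewrite powRM ?powR_ge0// [leRHS]EFinM; apply: lee_pmul; rewrite ?Lnorm_ge0//.
    apply/Lnorm_le_EFin => //; first exact: powR_ge0.
    have -> : ((B `^ s^-1) `^ r) `^ (s / r) = B.
      rewrite -!powRrM (_ : _ * _ = 1) ?powRr1//.
      by field; rewrite !gt_eqF.
    apply: le_trans wB; rewrite le_eqVlt; apply/orP; left; apply/eqP.
    apply: eq_integral => y _ /=; rewrite ger0_norm ?powR_ge0// -powRrM.
    by congr (_ `^ _)%:E; field; rewrite gt_eqF.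
  apply/Lnorm_le_EFin => //; first exact: powR_ge0.
  move/Lnorm_le_EFin : gM => /(_ q0 M0).
  have -> : (M `^ r) `^ (q / r) = M `^ q.
    by rewrite -powRrM; congr (_ `^ _); field; rewrite gt_eqF.
  apply: le_trans; rewrite le_eqVlt; apply/orP; left; apply/eqP.
  apply: eq_integral => y _ /=; rewrite !ger0_norm ?powR_ge0// -powRrM.
  by congr (_ `^ _)%:E; field; rewrite gt_eqF.
rewrite inv_exponent_pinfty addr0 => /invr_inj rs; rewrite {}rs in r0 *.
apply/Lnorm_le_EFin => //; first by rewrite mulr_ge0// powR_ge0.
have {}gM : {ae m, forall y, (g y <= M)%R}.
  by move/Lnorm_le_pinfty : gM => /(_ M0); apply: filterS => y /=; rewrite lee_fin ger0_norm.
rewrite powRM ?powR_ge0// powRVK//.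
apply: (@le_trans _ _ (\int[m]_y ((M `^ s)%:E * (w y `^ s)%:E))%E).
  apply: ae_ge0_le_integral => //.
  - by move=> y _; exact: poweR_ge0.
  - apply/(measurableT_comp (measurable_poweR _)) => /=.
    by do 2 apply: measurableT_comp => //; exact: measurable_funM.
  - by move=> y _; rewrite mule_ge0 ?lee_fin ?powR_ge0.
  - apply/measurable_funeM/measurable_EFinP.
    exact: (measurableT_comp (measurable_powR _)).
  - apply: filterS gM => y gyM _ /=.
    rewrite lee_fin ger0_norm ?mulr_ge0// powRM// mulrC ler_wpM2r ?powR_ge0//.
    by rewrite ge0_ler_powR ?nnegrE// ltW.
rewrite ge0_integralZl_EFin ?powR_ge0//.
- by rewrite mulrC EFinM lee_wpmul2l// lee_fin powR_ge0.
- by move=> y _; rewrite lee_fin powR_ge0.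
- exact/measurable_EFinP/(measurableT_comp (measurable_powR _)).
Qed.

End weighted_hoelder.

Section young.
Context {d} {T : measurableType d} {R : realType}.
Variable m : {sigma_finite_measure set T -> \bar R}.
Variables (k : T * T -> R) (A : R).
Hypothesis mk : measurable_fun setT k.
Hypothesis k01 : forall z, 0 <= k z <= 1.
Hypothesis A0 : 0 < A.
Hypothesis kA1 : forall x, (\int[m]_y (k (x, y))%:E <= A%:E)%E.
Hypothesis kA2 : forall y, (\int[m]_x (k (x, y))%:E <= A%:E)%E.

Definition kernel_op (g : T -> R) (x : T) : \bar R :=
  (\int[m]_y (k (x, y) * g y)%:E)%E.

Let k0 z : 0 <= k z. Proof. by have /andP[] := k01 z. Qed.

Let mkx x : measurable_fun setT (fun y => k (x, y)).
Proof. exact: measurableT_comp mk (measurable_pair1 x). Qed.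

Let mk_mul (g : T -> R) : measurable_fun setT g ->
  measurable_fun setT (fun z => (k z * g z.2)%:E).
Proof.
move=> mg; apply/measurable_EFinP/measurable_funM => //.
exact: measurableT_comp mg measurable_snd.
Qed.

Lemma kernel_op_ge0 (g : T -> R) x : (forall y, 0 <= g y) ->
  (0 <= kernel_op g x)%E.
Proof. by move=> g0; apply: integral_ge0 => y _; rewrite lee_fin mulr_ge0. Qed.

Lemma measurable_kernel_op (g : T -> R) :
  measurable_fun setT g -> (forall y, 0 <= g y) ->
  measurable_fun setT (kernel_op g).
Proof.
move=> mg g0; have h z : (0 <= (k z * g z.2)%:E)%E by rewrite lee_fin mulr_ge0.
exact: (measurable_fun_fubini_tonelli_F (m2 := m) _ (mk_mul mg) h).
Qed.

(** By [jensen_weight] the power [r] of the value is at most [A^(r - 1)] times the integral of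
    [k g^r], and [k <= 1] then removes the kernel. For [r = +oo] the bound [M] of [g] comes out of
    the integral, which leaves the mass of the kernel. *)
Lemma kernel_op_le_sup (g : T -> R) (r : \bar R) (M : R) :
  measurable_fun setT g -> (forall y, 0 <= g y) -> (1 <= r)%E -> 0 <= M ->
  ('N[m]_r [EFin \o g] <= M%:E)%E ->
  forall x, (kernel_op g x <= (A `^ (1 - inv_exponent r) * M)%:E)%E.
Proof.
move=> mg g0; case: r => [r|_ M0|//].
  rewrite lee_fin => r1 M0 gM x.
  have r0 : 0 < r by rewrite (lt_le_trans _ r1).
  rewrite inv_exponent_fin ?gt_eqF//.
  have H := jensen_weight (m := m) (k := fun y => k (x, y)) (mkx x) mg (fun y => k0 _) g0
     (ltW A0) r1 (kA1 x).
  have {}H : (kernel_op g x `^ r <= ((A `^ (r - 1)) * M `^ r)%:E)%E.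
    apply: le_trans H _; rewrite EFinM lee_wpmul2l ?lee_fin ?powR_ge0//.
    move/Lnorm_le_EFin : gM => /(_ r0 M0); apply: le_trans.
    apply: ge0_le_integral => //.
    - by move=> y _; rewrite lee_fin mulr_ge0 ?powR_ge0.
    - apply/measurable_EFinP/measurable_funM => //.
      exact: (measurableT_comp (measurable_powR _)).
    - apply: measurableT_comp (measurable_poweR _) _.
      by do 2 apply: measurableT_comp => //.
    - move=> y _ /=; rewrite lee_fin ger0_norm// ler_piMl ?powR_ge0//.
      by case/andP : (k01 (x, y)).
  have r'0 : 0 <= r^-1 by rewrite invr_ge0 ltW.
  have := gt0_ler_poweR r'0 _ _ H.
  rewrite -poweRrM mulfV ?gt_eqF// poweRe1 ?kernel_op_ge0//.
  rewrite poweR_EFin powRM ?powR_ge0// -!powRrM mulfV ?gt_eqF// powRr1//.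
  rewrite mulrBl mul1r mulfV ?gt_eqF//; apply.
    by rewrite in_itv/= leey poweR_ge0.
  by rewrite in_itv/= leey lee_fin mulr_ge0 ?powR_ge0.
move=> /Lnorm_le_pinfty => /(_ M0) gM x.
rewrite inv_exponent_pinfty subr0 powRr1 ?(ltW A0)//.
apply: (@le_trans _ _ (\int[m]_y (M%:E * (k (x, y))%:E))%E).
  apply: ae_ge0_le_integral => //.
  - by move=> y _; rewrite lee_fin mulr_ge0.
  - exact/measurable_EFinP/measurable_funM.
  - by move=> y _; rewrite mule_ge0 ?lee_fin.
  - by apply/measurable_funeM/measurable_EFinP.
  - apply: filterS gM => y /= gyM _.
    by move: gyM; rewrite !lee_fin ger0_norm// mulrC => gyM; rewrite ler_wpM2r.
rewrite ge0_integralZl_EFin//.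
- by rewrite (mulrC A) EFinM lee_wpmul2l.
- by move=> y _; rewrite lee_fin.
- exact/measurable_EFinP.
Qed.

(** After [jensen_weight], Tonelli's theorem lets the kernel be integrated in [x] first. The bound
    on its mass in [y] contributes [A^(r - 1)], the one on its mass in [x] a further factor [A]. *)
Lemma kernel_op_le_diag (g : T -> R) (r M : R) :
  measurable_fun setT g -> (forall y, 0 <= g y) -> 1 <= r -> 0 <= M ->
  ('N[m]_(r%:E) [EFin \o g] <= M%:E)%E ->
  (\int[m]_x (kernel_op g x `^ r) <= ((A * M) `^ r)%:E)%E.
Proof.
move=> mg g0 r1 M0 gM.
have r0 : 0 < r by rewrite (lt_le_trans _ r1).
have mgr : measurable_fun setT (fun y => g y `^ r).
  exact: (measurableT_comp (measurable_powR _)).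
have gr0 y : 0 <= g y `^ r by exact: powR_ge0.
have H x := jensen_weight (m := m) (k := fun y => k (x, y)) (mkx x) mg (fun y => k0 _) g0
     (ltW A0) r1 (kA1 x).
apply: (@le_trans _ _ (\int[m]_x ((A `^ (r - 1))%:E * kernel_op (fun y => g y `^ r)%R x))%E).
  apply: ge0_le_integral => //.
  - by move=> x _; exact: poweR_ge0.
  - apply: measurableT_comp (measurable_poweR _) _; exact: measurable_kernel_op.
  - apply: measurable_funeM; exact: measurable_kernel_op.
  - by move=> x _; exact: H.
rewrite ge0_integralZl_EFin ?powR_ge0//; last 2 first.
- by move=> x _; exact: kernel_op_ge0.
- exact: measurable_kernel_op.
rewrite /kernel_op (fubini_tonelli _ (mk_mul mgr)); last first.
  by move=> z; rewrite lee_fin mulr_ge0.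
have -> : (A * M) `^ r = A `^ (r - 1) * (A * M `^ r).
  by rewrite powRM ?(ltW A0)// -(mulr_powRB1 (ltW A0) r0) mulrCA mulrA.
rewrite EFinM lee_wpmul2l ?lee_fin ?powR_ge0//.
move/Lnorm_le_EFin : gM => /(_ r0 M0) gM.
apply: (@le_trans _ _ (\int[m]_y (A%:E * (g y `^ r)%:E))%E).
  apply: ge0_le_integral => //.
  - by move=> y _; apply: integral_ge0 => x _; rewrite lee_fin mulr_ge0.
  - have h z : (0 <= (k z * g z.2 `^ r)%:E)%E by rewrite lee_fin mulr_ge0.
    exact: (measurable_fun_fubini_tonelli_G (m1 := m) _ (mk_mul mgr) h).
  - exact/measurable_funeM/measurable_EFinP.
  - move=> y _ /=.
    under eq_integral do rewrite mulrC EFinM.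
    rewrite ge0_integralZl_EFin//.
    + by rewrite muleC lee_wpmul2r ?lee_fin.
    + by move=> x _; rewrite lee_fin.
    + by apply/measurable_EFinP; exact: measurableT_comp mk (measurable_pair2 y).
rewrite ge0_integralZl_EFin ?(ltW A0)//.
- rewrite [leRHS]EFinM; apply: lee_wpmul2l; first by rewrite lee_fin ltW.
  apply: le_trans gM; rewrite le_eqVlt; apply/orP; left; apply/eqP.
  by apply: eq_integral => y _ /=; rewrite ger0_norm.
- by move=> y _; rewrite lee_fin.
- exact/measurable_EFinP.
Qed.

(* For r <= q < +oo, F^q <= (sup F)^(q - r) F^r. *)
Lemma young (g : T -> R) (r q : \bar R) (M : R) :
  measurable_fun setT g -> (forall y, 0 <= g y) -> (1 <= r)%E -> (r <= q)%E ->
  0 <= M -> ('N[m]_r [EFin \o g] <= M%:E)%E ->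
  ('N[m]_q [kernel_op g] <=
     (A `^ (1 - inv_exponent r + inv_exponent q) * M)%:E)%E.
Proof.
move=> mg g0 r1 rq M0 gM.
have S := kernel_op_le_sup mg g0 r1 M0 gM.
case: q rq => [q rq|_|]; last by case: r r1 gM S.
  case: r r1 rq gM S => [r| //|//]; rewrite !lee_fin => r1 rq gM S.
  have r0 : 0 < r by rewrite (lt_le_trans _ r1).
  have q0 : 0 < q by rewrite (lt_le_trans _ rq).
  rewrite !inv_exponent_fin ?gt_eqF// in S *.
  set a := A `^ (1 - r^-1) * M in S.
  have a0 : 0 <= a by rewrite mulr_ge0 ?powR_ge0.
  apply/Lnorm_le_EFin => //; first by rewrite mulr_ge0 ?powR_ge0.
  (* The powers of [A] agree since [(1 - 1/r)(q - r) + r = q (1 - 1/r + 1/q)]. *)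
  have -> : (A `^ (1 - r^-1 + q^-1) * M) `^ q = a `^ (q - r) * (A * M) `^ r.
    rewrite /a !powRM ?powR_ge0 ?(ltW A0)// -!powRrM mulrACA.
    rewrite -!powRD ?(gt_eqF A0) ?implybT//; last first.
      rewrite subrK.
      by apply/implyP => /eqP q0'; rewrite q0' ltxx in q0.
    rewrite subrK; congr (_ `^ _ * _).
    by field; rewrite !gt_eqF.
  apply: (@le_trans _ _ (\int[m]_x ((a `^ (q - r))%:E * kernel_op g x `^ r))%E).
    apply: ge0_le_integral => //.
    - by move=> x _; exact: poweR_ge0.
    - apply: measurableT_comp (measurable_poweR _) _.
      by apply: measurableT_comp => //; exact: measurable_kernel_op.
    - apply: measurable_funeM; apply: measurableT_comp (measurable_poweR _) _.
      exact: measurable_kernel_op.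
    - move=> x _; rewrite gee0_abs ?kernel_op_ge0//.
      have := S x; have := kernel_op_ge0 x g0.
      case: (kernel_op g x) => [z| |]//; rewrite !lee_fin => z0 za.
      have -> : z `^ q = z `^ (q - r) * z `^ r.
        by rewrite -powRD subrK ?(gt_eqF q0).
      by rewrite ler_wpM2r ?powR_ge0// ge0_ler_powR ?subr_ge0 ?nnegrE.
  rewrite ge0_integralZl_EFin ?powR_ge0//.
  - by rewrite EFinM lee_wpmul2l ?lee_fin ?powR_ge0// kernel_op_le_diag.
  - by move=> x _; exact: poweR_ge0.
  - by apply: measurableT_comp (measurable_poweR _) _; exact: measurable_kernel_op.
rewrite inv_exponent_pinfty addr0.
apply/Lnorm_le_pinfty; first by rewrite mulr_ge0 ?powR_ge0.
by apply: aeW => x; rewrite gee0_abs ?kernel_op_ge0.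
Qed.

End young.

(** * Integrals over R^N by dyadic cubes *)

Section euclidean_norm.
Context {R : realType} {N : nat}.
Implicit Types x y : euclid R N.

Lemma enorm_ge0 x : 0 <= enorm x.
Proof. exact: sqrtr_ge0. Qed.

Lemma sqr_enorm x : enorm x ^+ 2 = \sum_(i < N) tnth x i ^+ 2.
Proof. by rewrite sqr_sqrtr// sumr_ge0// => i _; exact: sqr_ge0. Qed.

Lemma le_tnth_enorm x i : `|tnth x i : R| <= enorm x.
Proof.
rewrite -sqrtr_sqr ler_wsqrtr// (bigD1 i)//= lerDl sumr_ge0// => j _.
exact: sqr_ge0.
Qed.

Lemma enorm_esubC x y : enorm (esub x y) = enorm (esub y x).
Proof.
congr Num.sqrt; apply: eq_bigr => i _.
by rewrite !tnth_mktuple -sqrrN opprB.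
Qed.

(** In each coordinate the right side minus the left side is [(a - 2 b)^2]. This takes the place of
    the triangle inequality. *)
Lemma sqr_enorm_le x y :
  enorm x ^+ 2 <= 2 * enorm (esub x y) ^+ 2 + 2 * enorm y ^+ 2.
Proof.
rewrite !sqr_enorm !mulr_sumr -big_split/= ler_sum// => i _.
rewrite tnth_mktuple; move: (tnth x i : R) (tnth y i : R) => a b.
by rewrite -subr_ge0; have := sqr_ge0 (a - 2 * b); rewrite !expr2; lra.
Qed.

Let enormE x : enorm x = (\sum_(i < N) tnth x i ^+ 2) `^ 2^-1.
Proof. by rewrite powR12_sqrt// sumr_ge0// => i _; exact: sqr_ge0. Qed.

Lemma measurable_enorm : measurable_fun setT (@enorm R N).
Proof.
rewrite (funext enormE).
  apply: (measurableT_comp (measurable_powR _)); apply: measurable_sum => i.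
  by apply: measurable_funX; exact: measurable_tnth.
Qed.

Lemma measurable_enorm_esub :
  measurable_fun setT (fun z : euclid R N * euclid R N => enorm (esub z.1 z.2)).
Proof.
under eq_fun do rewrite enormE.
  apply: (measurableT_comp (measurable_powR _)); apply: measurable_sum => i.
  under eq_fun do rewrite tnth_mktuple.
  apply: measurable_funX; apply: measurable_funB.
  - exact: measurableT_comp (measurable_tnth i) measurable_fst.
  - exact: measurableT_comp (measurable_tnth i) measurable_snd.
Qed.

(** The closed ball of the maximum norm. As a product of intervals it has an explicit measure, and
    it contains the Euclidean ball of the same radius. *)
Definition cube x (r : R) : set (euclid R N) :=
  [set y | forall i, `|(tnth x i : R) - tnth y i| <= r].

Let cubeE x r : cube x r =
  [set y | forall i, [set` `[(tnth x i : R) - r, tnth x i + r]] (tnth y i)].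
Proof.
apply/seteqP; split => y /= xy i; have := xy i; rewrite /= in_itv/= ler_norml.
  by move=> /andP[? ?]; apply/andP; split; lra.
by move=> /andP[? ?]; apply/andP; split; lra.
Qed.

Lemma measurable_cube x r : measurable (cube x r).
Proof.
rewrite cubeE (_ : mkset _ = \bigcap_(i in [set: 'I_N])
    ((fun y : euclid R N => tnth y i) @^-1` [set` `[(tnth x i : R) - r, tnth x i + r]])).
  apply: fin_bigcap_measurable => [|i _]; first exact: finite_finset.
  rewrite -[X in measurable X]setTI.
  by apply: measurable_tnth => //; exact: measurable_itv.
by apply/seteqP; split => [y yP i _|y yP i]; [exact: yP|exact: yP].
Qed.

Lemma lebesgueN_cube x r : 0 <= r ->
  lebesgueN R N (cube x r) = ((2 * r) ^+ N)%:E.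
Proof.
move=> r0; rewrite cubeE (@lebesgueN_box R N
  (fun i => [set` `[(tnth x i : R) - r, tnth x i + r]])); last by move=> i; exact: measurable_itv.
rewrite (eq_bigr (fun _ => (2 * r)%:E)) => [|i _].
  by rewrite prodEFin prodr_const card_ord.
rewrite lebesgue_measure_itv/= lte_fin.
(* The case [r = 0] is wanted: it is the null set that later removes the origin. *)
move: r0; rewrite le_eqVlt => /predU1P[<-|r0].
  by rewrite subr0 addr0 ltxx mulr0.
rewrite ifT; last by lra.
by rewrite -EFinB; congr EFin; lra.
Qed.

(** [h] lies below the sum over [k] of [a k] times the indicator of the cube of radius [r k], whose
    integral is at most a geometric series. The cubes may overlap, so no shells have to be measured;
    the alternative [h y = 0] admits functions cut off outside a ball. *)
Lemma integral_dyadic_le (h : euclid R N -> R) x (a r : nat -> R) (D th : R) :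
  measurable_fun setT h -> (forall y, 0 <= h y) ->
  (forall k, 0 <= a k) -> (forall k, 0 <= r k) -> 0 <= D -> 0 < th < 1 ->
  (forall k, a k * (2 * r k) ^+ N <= D * th ^+ k) ->
  (forall y, exists k, h y = 0 \/ h y <= a k /\ cube x (r k) y) ->
  (\int[lebesgueN R N]_y (h y)%:E <= (D / (1 - th))%:E)%E.
Proof.
move=> mh h0 a0 r0 D0 /andP[th0 th1] aD hE.
pose F k y : \bar R := ((a k)%:E * (\1_(cube x (r k)) y)%:E)%E.
have F0 k y : (0 <= F k y)%E by rewrite mule_ge0 ?lee_fin.
have mF k : measurable_fun setT (F k).
  apply: measurable_funeM; apply/measurable_EFinP.
  by apply: measurable_indic; exact: measurable_cube.
apply: (@le_trans _ _ (\int[lebesgueN R N]_y (\sum_(0 <= k <oo) F k y))%E).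
  apply: ge0_le_integral => //.
  - by move=> y _; rewrite lee_fin.
  - exact/measurable_EFinP.
  - by apply: ge0_emeasurable_sum => // k y _ _; exact: F0.
  - move=> y _; have [k [->|[hk yk]]] := hE y; first exact: nneseries_ge0.
    apply: le_trans (nneseries_lim_ge k.+1 _) => //.
    rewrite big_nat_recr//= (_ : F k y = (a k)%:E).
      by apply: (@le_trans _ _ (a k)%:E); rewrite ?lee_fin// leeDr// sume_ge0.
    by rewrite /F indicE mem_set// mule1.
rewrite integral_nneseries//.
apply: lime_le; first by apply: is_cvg_nneseries => k _ _; exact: integral_ge0.
apply: nearW => n.
apply: (@le_trans _ _ (series (geometric D th) n)%:E).
  rewrite /series/= -sumEFin.
  apply: lee_sum => k _; rewrite ge0_integralZl_EFin//.
  - rewrite integral_indic ?setIT//; last exact: measurable_cube.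
    by rewrite [X in (_ * X)%E]lebesgueN_cube// -EFinM lee_fin.
  - by apply/measurable_EFinP; apply: measurable_indic; exact: measurable_cube.
by rewrite lee_fin geometric_le_lim// ger0_norm// ltW.
Qed.

(** Powers of two are integers, so the bounds for the integer part of [s], given by its binary
    logarithm, carry over to [s]. *)
Lemma dyadic_index (s : R) : 1 <= s -> exists k, 2 ^+ k <= s < 2 ^+ k.+1.
Proof.
move=> s1; have /andP[ts st] := truncn_itv (le_trans ler01 s1).
have t0 : (0 < Num.trunc s)%N.
  by rewrite lt0n; apply: contraTneq st => ->; rewrite -leNgt.
have /andP[kt tk] := trunc_log_bounds (leqnn 2) t0.
exists (trunc_log 2 (Num.trunc s)); rewrite -!natrX; apply/andP; split.
  by apply: le_trans ts; rewrite ler_nat.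
by apply: lt_le_trans st _; rewrite ler_nat.
Qed.

(** Ratio of consecutive terms in the tail sum: doubling the radius multiplies the volume by [2^N]
    and the function by [2^(- c)]. *)
Let theta (c : R) : R := 2 ^+ N * 2 `^ (- c).

Let thetaP c : N%:R < c -> 0 < theta c < 1.
Proof.
move=> Nc; rewrite /theta -powR_mulrn// -powRD ?pnatr_eq0 ?implybT//.
rewrite powR_gt0//= /powR pnatr_eq0/= expR_lt1 nmulr_rlt0 ?subr_lt0//.
by rewrite ln_gt0// ltr1n.
Qed.

Let powR_expr (k : nat) (c : R) : (2 ^+ k) `^ c = (2 `^ c) ^+ k.
Proof. rewrite -(powR_mulrn k (ler0n R 2)) -(powR_mulrn k (powR_ge0 2 c)) -!powRrM.
by rewrite mulrC. Qed.

(** Where the maximum lies in [[2^k, 2^(k+1))], the integrand is at most [2^(- c k)] and [y] is in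
    the cube of radius [rho 2^(k+1)] about [x]. That cube has side [rho 2^(k+2)], hence the [4 ^+ N]
    in the constant. *)
Lemma integral_tail_le (c : R) : N%:R < c ->
  exists2 C, 0 < C & forall (rho : R) x, 0 < rho ->
  (\int[lebesgueN R N]_y (Num.max 1 (enorm (esub x y) / rho) `^ (- c))%:E
    <= (C * rho ^+ N)%:E)%E.
Proof.
move=> Nc; have /andP[th0 th1] := thetaP Nc.
exists (4 ^+ N / (1 - theta c)); first by rewrite divr_gt0 ?exprn_gt0// subr_gt0.
move=> rho x rho0.
rewrite mulrAC -exprMn.
apply: (@integral_dyadic_le _ x (fun k => (2 ^+ k) `^ (- c)) (fun k => rho * 2 ^+ k.+1)).
- apply: (measurableT_comp (measurable_powR _)); apply: measurable_maxr => //.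
  apply: measurable_funM => //.
  exact: measurableT_comp measurable_enorm_esub (measurable_pair1 x).
- by move=> y; exact: powR_ge0.
- by move=> k; exact: powR_ge0.
- by move=> k; rewrite mulr_ge0 ?exprn_ge0// ltW.
- by rewrite exprn_ge0// mulr_ge0// ltW.
- exact/andP.
- move=> k; rewrite powR_expr /theta exprS !exprMn -!exprM (mulnC k N).
  by rewrite le_eqVlt (_ : 4 = 2 * 2 :> R) ?exprMn; [apply/orP; left; apply/eqP; ring|ring].
- move=> y; set s := Num.max _ _.
  have [k /andP[ks sk]] : exists k, 2 ^+ k <= s < 2 ^+ k.+1.
    by apply: dyadic_index; rewrite le_max lexx.
  exists k; right; split.
    by rewrite !powRN lef_pV2 ?posrE ?powR_gt0 ?exprn_gt0 ?(lt_le_trans _ ks)//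
      ge0_ler_powR ?nnegrE ?exprn_ge0 ?(le_trans _ ks)// ?(le_trans _ (ltW Nc)).
  move=> i; have := le_tnth_enorm (esub x y) i; rewrite tnth_mktuple => /le_trans; apply.
  rewrite mulrC -ler_pdivrMr// (le_trans _ (ltW sk))//.
  by rewrite /s le_max lexx orbT.
Qed.

(** The cubes now shrink to the origin: where [rho / |y|] lies in [[2^k, 2^(k+1))], the integrand is
    at most [2^(b (k+1))] on a cube of side [2 rho / 2^k]. The ratio [th] is [2^(b - N)], below 1
    because [b < N]. *)
Lemma integral_singularity_le (b : R) : 0 <= b < N%:R ->
  exists2 C, 0 < C & forall rho : R, 0 < rho ->
  (\int[lebesgueN R N]_y
     (if enorm y <= rho then (enorm y / rho) `^ (- b) else 0)%:E
    <= (C * rho ^+ N)%:E)%E.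
Proof.
move=> /andP[b0 bN].
pose th : R := 2 `^ b * 2^-1 ^+ N.
have th0 : 0 < th by rewrite mulr_gt0 ?powR_gt0 ?exprn_gt0.
have th1 : th < 1.
  rewrite /th exprVn -powR_mulrn// -powRN -powRD ?pnatr_eq0 ?implybT//.
  by rewrite /powR pnatr_eq0/= expR_lt1 nmulr_rlt0 ?subr_lt0// ln_gt0// ltr1n.
exists (2 `^ b * 2 ^+ N / (1 - th)).
  by rewrite divr_gt0 ?mulr_gt0 ?powR_gt0 ?exprn_gt0// subr_gt0.
move=> rho rho0; rewrite mulrAC.
apply: (@integral_dyadic_le _ [tuple 0 | i < N] (fun k => (2 ^+ k.+1) `^ b)
   (fun k => rho / 2 ^+ k)).
- apply: measurable_fun_ifT => //.
    apply: measurable_fun_ler => //; exact: measurable_enorm.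
  apply: (measurableT_comp (measurable_powR _)).
  by apply: measurable_funM => //; exact: measurable_enorm.
- by move=> y; case: ifP => // _; exact: powR_ge0.
- by move=> k; exact: powR_ge0.
- by move=> k; rewrite divr_ge0 ?exprn_ge0// ltW.
- by rewrite !mulr_ge0 ?powR_ge0 ?exprn_ge0// ltW.
- by apply/andP.
- move=> k; rewrite powR_expr /th exprS !exprMn !exprVn -!exprM (mulnC k N).
  by rewrite le_eqVlt; apply/orP; left; apply/eqP; ring.
- move=> y; case: ifPn => [yr|_]; last by exists 0%N; left.
  have incube (r : R) : enorm y <= r -> cube [tuple 0 | i < N] r y.
    by move=> yr' i; rewrite tnth_mktuple sub0r normrN (le_trans (le_tnth_enorm _ _)).
  have := enorm_ge0 y; rewrite le_eqVlt => /predU1P[y0|y0].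
    (* At the origin the power of 0 is 0 for [b != 0] and 1 for [b = 0], so the bound for the
       largest cube covers it. *)
    exists 0%N; right; split; last by apply: incube; rewrite // expr0 divr1.
    rewrite -y0 mul0r; have [->|nb0] := eqVneq b 0; first by rewrite oppr0 !powRr0.
    by rewrite powR0 ?oppr_eq0// powR_ge0.
  have [k /andP[ks sk]] : exists k, 2 ^+ k <= rho / enorm y < 2 ^+ k.+1.
    by apply: dyadic_index; rewrite ler_pdivlMr// mul1r.
  exists k; right; split; last first.
    by apply: incube; rewrite // ler_pdivlMr ?exprn_gt0// mulrC -ler_pdivlMr.
  rewrite powRN -powR_inv1 ?powR_ge0// -powRrM mulrN1 -mulN1r powRrM.
  rewrite powR_inv1 ?divr_ge0 ?enorm_ge0 ?(ltW rho0)//.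
  by rewrite invf_div ge0_ler_powR ?nnegrE ?divr_ge0 ?exprn_ge0 ?enorm_ge0 ?(ltW rho0)// ltW.
Qed.

End euclidean_norm.

(** * Pointwise bound of the heat kernel *)

Section heat_kernel_bound.
Context {R : realType}.

(** Choose an integer [n > 0] with [e <= 2 n]. Then [max(1, s)^2 <= 1 + s^2 <= 4 n exp(s^2 / (4
    n))], and the [n]-th power of the last exponential is exactly [exp(s^2 / 4)]. *)
Lemma gauss_powR_bounded (e : R) : exists2 C, 0 < C &
  forall s : R, 0 <= s -> expR (- (s ^+ 2 / 4)) * Num.max 1 s `^ e <= C.
Proof.
set n := (Num.trunc `|e|).+1.
have en : e <= n.*2%:R.
  rewrite (le_trans (ler_norm e))//; have /andP[_ /ltW] := truncn_itv (normr_ge0 e).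
  move=> /le_trans; apply; rewrite ler_nat -/n -addnn leq_addr//.
have c0 : 0 < 4 * n%:R :> R by rewrite mulr_gt0 ?ltr0n.
exists ((4 * n%:R) ^+ n) => [|s s0]; first by rewrite exprn_gt0.
set S := Num.max 1 s.
have S1 : 1 <= S by rewrite le_max lexx.
have S2 : S ^+ 2 <= 1 + s ^+ 2.
  by rewrite /S maxEle; case: ifP => _; rewrite ?expr1n ?lerDl ?lerDr ?sqr_ge0.
have exp_ge : 1 + s ^+ 2 <= 4 * n%:R * expR (s ^+ 2 / (4 * n%:R)).
  apply: (@le_trans _ _ (4 * n%:R * (1 + s ^+ 2 / (4 * n%:R)))); last first.
    by rewrite ler_wpM2l ?(ltW c0)// expR_ge1Dx.
  rewrite mulrDr mulr1 mulrCA divff ?gt_eqF// mulr1 lerD2r.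
  by rewrite -natrM ler1n muln_gt0.
rewrite expRN mulrC ler_pdivrMr ?expR_gt0//.
apply: (@le_trans _ _ ((S ^+ 2) ^+ n)).
  by rewrite -exprM mul2n -powR_mulrn ?(le_trans _ S1)// ler_powR.
apply: (@le_trans _ _ ((4 * n%:R * expR (s ^+ 2 / (4 * n%:R))) ^+ n)).
  by rewrite lerXn2r ?nnegrE ?sqr_ge0 ?mulr_ge0 ?expR_ge0// (le_trans S2).
rewrite exprMn -expRM_natl ler_wpM2l ?exprn_ge0 ?(ltW c0)//.
rewrite ler_expR le_eqVlt; apply/orP; left; apply/eqP.
by field; rewrite gt_eqF ?ltr0n.
Qed.

(** The hypothesis on squares gives [a <= 2 max(b, c)], and a power of the maximum is at most the
    sum of the powers. This treats [g < 1] and [g >= 1] alike. *)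
Lemma powR_le_add (g a b c : R) : 0 <= g -> 0 <= a -> 0 <= b -> 0 <= c ->
  a ^+ 2 <= 2 * b ^+ 2 + 2 * c ^+ 2 ->
  a `^ g <= 2 `^ g * (b `^ g + c `^ g).
Proof.
move=> g0 a0 b0 c0 abc; have m0 : 0 <= Num.max b c by rewrite le_max b0.
apply: (@le_trans _ _ ((2 * Num.max b c) `^ g)).
  rewrite ge0_ler_powR ?nnegrE ?mulr_ge0//.
  rewrite -(@ler_pXn2r _ 2) ?nnegrE ?mulr_ge0// (le_trans abc)//.
  have := m0; rewrite maxEle; case: ifPn => [bc _|]; last rewrite -ltNge => /ltW cb _.
    have : b ^+ 2 <= c ^+ 2 by rewrite lerXn2r ?nnegrE.
    by rewrite exprMn; lra.
  have : c ^+ 2 <= b ^+ 2 by rewrite lerXn2r ?nnegrE.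
  by rewrite exprMn; lra.
rewrite powRM// ler_wpM2l ?powR_ge0//.
by rewrite maxEle; case: ifP => _; rewrite ?lerDl ?lerDr powR_ge0.
Qed.

Context {N : nat}.
Implicit Types x y : euclid R N.

(** The function Phi of [x - y], on pairs to serve as a kernel of [kernel_op]. The exponent exceeds
    the dimension, which makes it integrable. *)
Definition decay (rho : R) (z : euclid R N * euclid R N) : R :=
  Num.max 1 (enorm (esub z.1 z.2) / rho) `^ (- N.+1%:R).

Lemma heat_kernel_le (g : R) : 0 <= g ->
  exists2 C, 0 < C & forall rho x y, 0 < rho ->
    enorm x `^ g * heat_kernel (rho ^+ 2) (esub x y) <=
    C * rho `^ (g - N%:R) * (decay rho (x, y) * (1 + (enorm y / rho) `^ g)).
Proof.
(* The Gaussian has to absorb [S^g], which comes from the weight [|x|^g], and still leave the decay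
   [S^(- (N + 1))]. *)
move=> g0; have [K K0 KP] := gauss_powR_bounded (g + N.+1%:R).
pose c := (4 * pi) `^ (- (N%:R / 2)) : R.
have c0 : 0 < c by rewrite powR_gt0// mulr_gt0// pi_gt0.
exists (2 `^ g * c * K); first by rewrite !mulr_gt0// powR_gt0.
move=> rho x y rho0; rewrite /decay/=.
set z := enorm (esub x y) / rho; set Y := enorm y / rho.
have z0 : 0 <= z by rewrite divr_ge0 ?enorm_ge0// ltW.
have Y0 : 0 <= Y by rewrite divr_ge0 ?enorm_ge0// ltW.
set S := Num.max 1 z.
have S1 : 1 <= S by rewrite le_max lexx.
have S0 : 0 < S by rewrite (lt_le_trans _ S1).
have xE : enorm x `^ g = rho `^ g * (enorm x / rho) `^ g.
  rewrite -powRM ?divr_ge0 ?enorm_ge0 ?(ltW rho0)//.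
  by rewrite mulrCA divff ?gt_eqF// mulr1.
have kE : heat_kernel (rho ^+ 2) (esub x y) =
    c * rho `^ (- N%:R) * expR (- (z ^+ 2 / 4)).
  rewrite /heat_kernel powRM ?mulr_ge0 ?pi_ge0 ?(ltW rho0)// -/c.
  congr (_ * _ * expR (- _)).
    rewrite -powR_mulrn ?(ltW rho0)// -powRrM; congr (_ `^ _).
    by rewrite mulrN mulrCA divff ?mulr1// pnatr_eq0.
  by rewrite /z exprMn exprVn; field; rewrite gt_eqF.
have Xle : (enorm x / rho) `^ g <= 2 `^ g * (z `^ g + Y `^ g).
  apply: powR_le_add => //; first by rewrite divr_ge0 ?enorm_ge0// ltW.
  have := ler_wpM2r (sqr_ge0 rho^-1) (sqr_enorm_le x y).
  by rewrite /z /Y !exprMn; lra.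
have zYle : z `^ g + Y `^ g <= S `^ g * (1 + Y `^ g).
  rewrite mulrDr mulr1 lerD//.
    by rewrite ge0_ler_powR ?nnegrE ?(ltW S0)// le_max lexx orbT.
  rewrite ler_peMl ?powR_ge0//.
  by rewrite -(powRr0 S) ler_powR.
have SK : expR (- (z ^+ 2 / 4)) * S `^ g <= K * S `^ (- N.+1%:R).
  rewrite powRN ler_pdivlMr ?powR_gt0// -mulrA -powRD; first exact: KP.
  by rewrite (gt_eqF S0) implybT.
have -> : 2 `^ g * c * K * rho `^ (g - N%:R) * (S `^ (- N.+1%:R) * (1 + Y `^ g)) =
   rho `^ g * 2 `^ g * c * rho `^ (- N%:R) * (1 + Y `^ g) * (K * S `^ (- N.+1%:R)).
  by rewrite powRD ?(gt_eqF rho0) ?implybT//; ring.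
rewrite xE kE.
apply: (@le_trans _ _ (rho `^ g * (2 `^ g * (S `^ g * (1 + Y `^ g))) *
   (c * rho `^ (- N%:R) * expR (- (z ^+ 2 / 4))))).
  rewrite ler_wpM2r ?mulr_ge0 ?powR_ge0 ?expR_ge0//.
  rewrite ler_wpM2l ?powR_ge0// (le_trans Xle)// ler_wpM2l ?powR_ge0//.
have -> : rho `^ g * (2 `^ g * (S `^ g * (1 + Y `^ g))) *
   (c * rho `^ (- N%:R) * expR (- (z ^+ 2 / 4))) =
  rho `^ g * 2 `^ g * c * rho `^ (- N%:R) * (1 + Y `^ g) * (expR (- (z ^+ 2 / 4)) * S `^ g).
  by ring.
by rewrite ler_wpM2l// !mulr_ge0 ?addr_ge0 ?powR_ge0.
Qed.

Definition near_weight (mu rho : R) y : R :=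
  if enorm y <= rho then (enorm y / rho) `^ (- mu) else 0.

Definition far_weight (a rho : R) y : R := Num.max 1 (enorm y / rho) `^ (- a).

(** With [Y = |y| / rho]: if [Y <= 1], the left side is at most 2 and the near weight cancels
    [Y^mu]; if [Y > 1], the left side is at most [2 Y^g], and [Y^g] is the far weight times
    [Y^mu]. *)
Lemma weight_split (g mu rho : R) y : 0 <= g <= mu -> 0 < rho -> 0 < enorm y ->
  (1 + (enorm y / rho) `^ g) <=
  2 * rho `^ (- mu) * ((near_weight mu rho y + far_weight (mu - g) rho y) * enorm y `^ mu).
Proof.
move=> /andP[g0 gm] rho0 y0; rewrite /near_weight /far_weight.
have m0 : 0 <= mu by exact: le_trans gm.
set Y := enorm y / rho.
have Y0 : 0 < Y by rewrite divr_gt0.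
have -> : enorm y `^ mu = rho `^ mu * Y `^ mu.
  rewrite -powRM ?(ltW rho0) ?(ltW Y0)//; congr (_ `^ _).
  by rewrite mulrCA divff ?gt_eqF// mulr1.
rewrite (_ : 2 * _ * _ = (rho `^ (- mu) * rho `^ mu) * (2 * Y `^ mu) *
  ((if enorm y <= rho then Y `^ (- mu) else 0) + Num.max 1 Y `^ (- (mu - g)))); last by ring.
have powV (a : R) (b : R) : 0 < a -> a `^ (- b) * a `^ b = 1.
  by move=> a0; rewrite powRN mulVf// gt_eqF// powR_gt0.
rewrite powV// mul1r.
have [yr|ry] := leP (enorm y) rho.
  have Y1 : Y <= 1 by rewrite ler_pdivrMr// mul1r.
  have Yg : Y `^ g <= 1 by rewrite -(powRr0 Y) ger_powR ?Y0.
  rewrite mulrDr -mulrA [Y `^ mu * _]mulrC powV// mulr1.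
  rewrite (@le_trans _ _ 2)//; first by lra.
  by rewrite lerDl !mulr_ge0 ?powR_ge0.
have Y1 : 1 <= Y by rewrite ler_pdivlMr// mul1r ltW.
rewrite add0r (max_idPr Y1) -mulrA -powRD ?(gt_eqF Y0) ?implybT//.
rewrite (_ : mu + - (mu - g) = g); last by ring.
have : 1 <= Y `^ g by rewrite -(powRr0 Y) ler_powR.
by lra.
Qed.

Lemma weighted_heat_kernel_le (g mu : R) : 0 <= g <= mu ->
  exists2 C, 0 < C & forall rho x y (v : R), 0 < rho -> 0 < enorm y ->
    enorm x `^ g * heat_kernel (rho ^+ 2) (esub x y) * `|v| <=
    C * rho `^ (- (mu - g) - N%:R) *
    (decay rho (x, y) * (near_weight mu rho y * `|enorm y `^ mu * v|) +
     decay rho (x, y) * (far_weight (mu - g) rho y * `|enorm y `^ mu * v|)).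
Proof.
move=> gmu; have /andP[g0 _] := gmu.
have [C C0 CP] := heat_kernel_le g0.
exists (C * 2) => [|rho x y v rho0 y0]; first exact: mulr_gt0.
apply: le_trans (ler_wpM2r (normr_ge0 v) (CP rho x y rho0)) _.
have d0 : 0 <= decay rho (x, y) by exact: powR_ge0.
rewrite normrM (ger0_norm (powR_ge0 _ _)).
have H := weight_split gmu rho0 y0.
have k0 : 0 <= C * rho `^ (g - N%:R) * (decay rho (x, y)) * `|v|.
  by rewrite !mulr_ge0 ?powR_ge0 ?(ltW C0).
have := ler_wpM2l k0 H.
rewrite (_ : - (mu - g) - N%:R = (g - N%:R) + - mu); last by ring.
rewrite [rho `^ (_ + - mu)]powRD ?(gt_eqF rho0) ?implybT//.
move=> K; apply: le_trans (le_trans K _); rewrite le_eqVlt; apply/orP; left; apply/eqP; ring.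
Qed.

End heat_kernel_bound.

(** * Weighted smoothing *)

Lemma Lnorm_le_scale {d} {T : measurableType d} {R : realType}
    (m : {measure set T -> \bar R}) (q : \bar R) (c M : R) (F G : T -> \bar R) :
  measurable_fun setT F -> measurable_fun setT G -> (0 < q)%E -> 0 <= c -> 0 <= M ->
  (forall x, (`|F x| <= c%:E * `|G x|)%E) ->
  ('N[m]_q [G] <= M%:E -> 'N[m]_q [F] <= (c * M)%:E)%E.
Proof.
move=> mF mG + c0 M0 FG; case: q => [q||//].
  rewrite lte_fin => q0 /Lnorm_le_EFin => /(_ q0 M0) GM.
  apply/Lnorm_le_EFin; rewrite ?mulr_ge0//.
  have mpow (h : T -> \bar R) : measurable_fun setT h ->
      measurable_fun setT (fun x => `|h x| `^ q)%E.
    by move=> mh; apply: measurableT_comp (measurable_poweR _) _; exact: measurableT_comp.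
  apply: (@le_trans _ _ (\int[m]_x ((c `^ q)%:E * `|G x| `^ q))%E).
    apply: ge0_le_integral => //.
    - by move=> x _; exact: poweR_ge0.
    - exact: mpow.
    - by apply: measurable_funeM; exact: mpow.
    - move=> x _; rewrite -poweR_EFin -poweRM ?lee_fin//.
      apply: gt0_ler_poweR => //; first exact: ltW.
      - by rewrite in_itv/= leey abse_ge0.
      - by rewrite in_itv/= leey mule_ge0 ?lee_fin.
  rewrite ge0_integralZl_EFin ?powR_ge0//.
  - by rewrite powRM// EFinM; apply: lee_wpmul2l => //; rewrite lee_fin powR_ge0.
  - by move=> x _; exact: poweR_ge0.
  - exact: mpow.
move=> _ /Lnorm_le_pinfty => /(_ M0) GM.
apply/Lnorm_le_pinfty; rewrite ?mulr_ge0//.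
by apply: filterS GM => x GxM; rewrite (le_trans (FG x))// EFinM lee_wpmul2l.
Qed.

Section weighted_smoothing.
Context {R : realType} {N : nat}.
Implicit Types (x y : euclid R N) (q : \bar R).

Lemma decay01 (rho : R) (z : euclid R N * euclid R N) : 0 <= decay rho z <= 1.
Proof.
rewrite powR_ge0/= /decay; set S := Num.max _ _.
have S1 : 1 <= S by rewrite le_max lexx.
by rewrite -[leRHS](powRr0 S) ler_powR// oppr_le0.
Qed.

Lemma measurable_decay (rho : R) :
  measurable_fun setT (decay rho : euclid R N * euclid R N -> R).
Proof.
apply: (measurableT_comp (measurable_powR _)); apply: measurable_maxr => //.
by apply: measurable_funM => //; exact: measurable_enorm_esub.
Qed.

Lemma integral_decay_le : exists2 C : R, 0 < C & forall rho : R, 0 < rho ->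
  (forall x, (\int[lebesgueN R N]_y (decay rho (x, y))%:E <= (C * rho ^+ N)%:E)%E) /\
  (forall y, (\int[lebesgueN R N]_x (decay rho (x, y))%:E <= (C * rho ^+ N)%:E)%E).
Proof.
have [|C C0 CP] := @integral_tail_le R N N.+1%:R; first by rewrite ltr_nat.
exists C => // rho rho0; split => [x|y]; first exact: CP.
apply: le_trans (CP rho y rho0); rewrite le_eqVlt; apply/orP; left; apply/eqP.
by apply: eq_integral => x _; rewrite /decay/= enorm_esubC.
Qed.

Lemma near_weight_ge0 (mu rho : R) y : 0 <= near_weight mu rho y.
Proof. by rewrite /near_weight; case: ifP => // _; exact: powR_ge0. Qed.

Lemma measurable_near_weight (mu rho : R) :
  measurable_fun setT (near_weight mu rho : euclid R N -> R).
Proof.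
apply: measurable_fun_ifT => //.
  by apply: measurable_fun_ler => //; exact: measurable_enorm.
apply: (measurableT_comp (measurable_powR _)).
by apply: measurable_funM => //; exact: measurable_enorm.
Qed.

Lemma far_weight_ge0 (a rho : R) y : 0 <= far_weight a rho y.
Proof. exact: powR_ge0. Qed.

Lemma far_weight_le1 (a rho : R) y : 0 <= a -> far_weight a rho y <= 1.
Proof.
move=> a0; rewrite /far_weight; set S := Num.max _ _.
have S1 : 1 <= S by rewrite le_max lexx.
by rewrite -[leRHS](powRr0 S) ler_powR// oppr_le0.
Qed.

Lemma measurable_far_weight (a rho : R) :
  measurable_fun setT (far_weight a rho : euclid R N -> R).
Proof.
apply: (measurableT_comp (measurable_powR _)); apply: measurable_maxr => //.
by apply: measurable_funM => //; exact: measurable_enorm.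
Qed.

Lemma integral_near_weight_le (mu s : R) : 0 <= mu -> 0 < s -> mu * s < N%:R ->
  exists2 C : R, 0 < C & forall rho : R, 0 < rho ->
  (\int[lebesgueN R N]_y (near_weight mu rho y `^ s)%:E <= (C * rho ^+ N)%:E)%E.
Proof.
move=> mu0 s0 musN.
have [|C C0 CP] := @integral_singularity_le R N (mu * s).
  by rewrite musN andbT mulr_ge0// ltW.
exists C => // rho rho0; apply: le_trans (CP _ rho0).
rewrite le_eqVlt; apply/orP; left; apply/eqP.
apply: eq_integral => y _; congr EFin; rewrite /near_weight.
(* Outside the ball the weight is 0 and stays 0 after the power, since [s > 0]. *)
case: ifP => _; last by rewrite powR0 ?gt_eqF.
by rewrite -powRrM mulNr.
Qed.

Lemma integral_far_weight_le (a s : R) : N%:R < a * s ->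
  exists2 C : R, 0 < C & forall rho : R, 0 < rho ->
  (\int[lebesgueN R N]_y (far_weight a rho y `^ s)%:E <= (C * rho ^+ N)%:E)%E.
Proof.
move=> Nas; have [C C0 CP] := integral_tail_le Nas.
exists C => // rho rho0; apply: le_trans (CP _ [tuple 0 | i < N] rho0).
rewrite le_eqVlt; apply/orP; left; apply/eqP.
apply: eq_integral => y _; congr EFin; rewrite /far_weight -powRrM mulNr.
congr (Num.max 1 (Num.sqrt _ / _) `^ _); apply: eq_bigr => i _.
by rewrite !tnth_mktuple sub0r sqrrN.
Qed.

Let scale_powR (rho C1 C2 a b e : R) : 0 < rho -> 0 < C1 -> 0 < C2 -> e = a + b ->
  (C1 * rho ^+ N) `^ a * (C2 * rho ^+ N) `^ b =
  C1 `^ a * C2 `^ b * rho `^ (N%:R * e).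
Proof.
move=> rho0 C10 C20 ->; have rhoN0 : 0 < rho ^+ N by exact: exprn_gt0.
rewrite !powRM ?ltW// mulrACA; congr (_ * _).
rewrite -powRD ?(gt_eqF rhoN0) ?implybT//.
by rewrite -powR_mulrn ?(ltW rho0)// -powRrM.
Qed.

(* Finiteness of F makes Minkowski's inequality, which the library states for
   real-valued functions, applicable to a sum of two such F. *)
Definition smoothing (w : R -> euclid R N -> R) (q1 q2 : \bar R) : Prop :=
  exists2 C : R, 0 < C & forall (rho M : R) (f : euclid R N -> R),
    0 < rho -> 0 <= M -> measurable_fun setT f -> (forall y, 0 <= f y) ->
    ('N[lebesgueN R N]_q1 [EFin \o f] <= M%:E)%E ->
    let F := kernel_op (lebesgueN R N) (decay rho) (w rho \* f)%R in
    (forall x, F x < +oo)%E /\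
    ('N[lebesgueN R N]_q2 [F] <=
      (C * rho `^ (N%:R * (1 + inv_exponent q2 - inv_exponent q1)) * M)%:E)%E.

(** The weight maps L^q1 to L^r at the cost [rho^(N (1/r - 1/q1))], and [young] maps L^r to L^q2 at
    the cost [rho^(N (1 - 1/r + 1/q2))]; the auxiliary [1/r] cancels. Finiteness follows from the
    supremum bound. *)
Lemma smoothing_of_weight (w : R -> euclid R N -> R) (q1 q2 r : \bar R) :
  (forall rho, measurable_fun setT (w rho)) -> (forall rho y, 0 <= w rho y) ->
  (1 <= r)%E -> (r <= q2)%E ->
  (exists2 C : R, 0 < C & forall (rho M : R) (f : euclid R N -> R),
    0 < rho -> 0 <= M -> measurable_fun setT f -> (forall y, 0 <= f y) ->
    ('N[lebesgueN R N]_q1 [EFin \o f] <= M%:E)%E ->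
    ('N[lebesgueN R N]_r [EFin \o (w rho \* f)%R] <=
      ((C * rho ^+ N) `^ (inv_exponent r - inv_exponent q1) * M)%:E)%E) ->
  smoothing w q1 q2.
Proof.
move=> mw w0 r1 rq2 [B B0 BP]; have [A A0 AP] := integral_decay_le.
exists (A `^ (1 - inv_exponent r + inv_exponent q2) * B `^ (inv_exponent r - inv_exponent q1)).
  by rewrite mulr_gt0// powR_gt0.
move=> rho M f rho0 M0 mf f0 fM F; have [A1 A2] := AP rho rho0.
have ArhoN : 0 < A * rho ^+ N by rewrite mulr_gt0// exprn_gt0.
have mwf : measurable_fun setT (w rho \* f)%R by exact: measurable_funM.
have wf0 y : 0 <= (w rho \* f)%R y by rewrite mulr_ge0.
have wfM := BP rho M f rho0 M0 mf f0 fM.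
have M'0 : 0 <= (B * rho ^+ N) `^ (inv_exponent r - inv_exponent q1) * M.
  by rewrite mulr_ge0 ?powR_ge0.
split=> [x|].
  apply: le_lt_trans (kernel_op_le_sup (measurable_decay rho) (decay01 rho) ArhoN A1
    mwf wf0 r1 M'0 wfM x) _.
  exact: ltry.
have := young (measurable_decay rho) (decay01 rho) ArhoN A1 A2 mwf wf0 r1 rq2 M'0 wfM.
by rewrite mulrA (scale_powR (e := 1 + inv_exponent q2 - inv_exponent q1))//; ring.
Qed.

(** Here [r = 1]. Hölder's inequality puts the weight in the space with the conjugate exponent
    [s = 1 / (1 - 1/q1)], where its integral is finite because [mu s < N]. *)
Lemma near_smoothing (mu : R) (q1 q2 : \bar R) : 0 <= mu -> (1 < q1)%E -> (1 < q2)%E ->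
  inv_exponent q1 < 1 -> mu < N%:R * (1 - inv_exponent q1) ->
  smoothing (near_weight mu) q1 q2.
Proof.
move=> mu0 q11 q21 i1 muN; have i1' : 0 < 1 - inv_exponent q1 by rewrite subr_gt0.
apply: (@smoothing_of_weight _ _ _ 1%E) => //; last 1 first.
- have [||B B0 BP] := @integral_near_weight_le mu (1 - inv_exponent q1)^-1 mu0.
  + by rewrite invr_gt0.
  + by rewrite ltr_pdivrMr.
  exists B => // rho M f rho0 M0 mf f0 fM.
  rewrite (@inv_exponent_fin _ 1) ?oner_eq0// invr1.
  rewrite -[X in _ `^ X]invrK.
  apply: Lnorm_weight_le fM => //; rewrite ?invr_gt0//.
  + exact: measurable_near_weight.
  + exact: near_weight_ge0.
  + exact: lt_trans q11.
  + by rewrite invrK invr1 subrK.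
  + by rewrite mulr_ge0 ?exprn_ge0 ?ltW.
  + exact: BP.
- exact: measurable_near_weight.
- exact: near_weight_ge0.
- exact: ltW.
Qed.

(** If [1/q2 <= 1/q1], take [r = q1] and bound the weight by 1. Otherwise take [r = q2]: the weight
    is measured with exponent [s = 1 / (1/q2 - 1/q1)], and the hypothesis says [a s > N]. *)
Lemma far_smoothing (a : R) (q1 q2 : \bar R) : 0 <= a -> (1 < q1)%E -> (1 < q2)%E ->
  N%:R * (inv_exponent q2 - inv_exponent q1) < a ->
  smoothing (far_weight a) q1 q2.
Proof.
move=> a0 q11 q21 aN.
have [q2q1|q1q2] := leP (inv_exponent q2) (inv_exponent q1).
  apply: (@smoothing_of_weight _ _ _ q1) => //; last 1 first.
  (* The power of [C * rho ^+ N] has exponent 0 here, so any positive constant serves. *)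
  - exists 1 => // rho M f rho0 M0 mf f0 fM.
    rewrite subrr powRr0; apply: Lnorm_le_scale fM => //.
    + by apply/measurable_EFinP/measurable_funM => //; exact: measurable_far_weight.
    + exact/measurable_EFinP.
    + exact: lt_trans q11.
    + move=> y /=; rewrite mul1e lee_fin normrM ler_piMl// ger0_norm ?far_weight_le1//.
      exact: far_weight_ge0.
  - exact: measurable_far_weight.
  - exact: far_weight_ge0.
  - exact: ltW.
  - case: q2 q1 q11 q21 q2q1 {aN} => [r2||//] [r1||//] //; rewrite ?leey// !lte_fin.
    + move=> r11 r21; rewrite !inv_exponent_fin ?gt_eqF ?(lt_trans ltr01)//.
      by rewrite lef_pV2 ?posrE ?(lt_trans ltr01).
    + move=> _ r21; rewrite inv_exponent_pinfty inv_exponent_fin ?gt_eqF ?(lt_trans ltr01)//.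
      by rewrite invr_le0 leNgt (lt_trans ltr01).
(* An infinite [q2] would make [1/q1] negative. *)
case: q2 q21 q1q2 aN => [r2||//]; last first.
  by move=> _; rewrite inv_exponent_pinfty ltNge inv_exponent_ge0// (le_trans _ (ltW q11)).
rewrite lte_fin => r21; have r20 : 0 < r2 by exact: lt_trans r21.
rewrite inv_exponent_fin ?gt_eqF// => q1r2 aN.
have d0 : 0 < r2^-1 - inv_exponent q1 by rewrite subr_gt0.
apply: (@smoothing_of_weight _ _ _ r2%:E) => //; last 1 first.
- have [|B B0 BP] := @integral_far_weight_le a (r2^-1 - inv_exponent q1)^-1.
    by rewrite ltr_pdivlMr.
  exists B => // rho M f rho0 M0 mf f0 fM.
  rewrite inv_exponent_fin ?gt_eqF// -[X in _ `^ X]invrK.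
  apply: Lnorm_weight_le fM => //; rewrite ?invr_gt0//.
  + exact: measurable_far_weight.
  + exact: far_weight_ge0.
  + exact: lt_trans q11.
  + by rewrite invrK subrK.
  + by rewrite mulr_ge0 ?exprn_ge0 ?ltW.
  + exact: BP.
- exact: measurable_far_weight.
- exact: far_weight_ge0.
- by rewrite lee_fin ltW.
Qed.

End weighted_smoothing.

(** * Measurability and pointwise bound of the heat semigroup *)

Section heat_semigroup_bound.
Context {R : realType} {N : nat}.
Implicit Types (x y : euclid R N).

(** The origin is a cube of side 0, which is null once the dimension is positive. *)
Lemma ae_enorm_gt0 : (0 < N)%N -> {ae lebesgueN R N, forall y, 0 < enorm y}.
Proof.
move=> N0; exists (cube [tuple 0 | i < N] 0); split; first exact: measurable_cube.
  by rewrite [LHS]lebesgueN_cube// mulr0 expr0n gtn_eqF.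
move=> y /= /negP; rewrite -leNgt => y0 i.
by rewrite tnth_mktuple sub0r normrN (le_trans (le_tnth_enorm _ _)).
Qed.

(** Membership in the weighted space gives measurability of the product only. Off the origin [u] is
    recovered by dividing by the weight, and at the single remaining point it is a constant. *)
Lemma measurable_of_weighted (mu : R) (u : euclid R N -> R) :
  measurable_fun setT (fun y => enorm y `^ mu * u y) -> measurable_fun setT u.
Proof.
move=> mh; pose o : euclid R N := [tuple 0 | i < N].
have -> : u = fun y => if enorm y <= 0 then u o else
    enorm y `^ (- mu) * (enorm y `^ mu * u y).
  apply/funext => y; case: ifPn => [y0|]; last first.
    rewrite -ltNge => y0; rewrite mulrA powRN mulVf ?mul1r//.
    by rewrite gt_eqF// powR_gt0.
  congr u; apply: eq_from_tnth => i; rewrite tnth_mktuple.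
  by apply/eqP; rewrite -normr_le0 (le_trans (le_tnth_enorm _ _)).
apply: measurable_fun_ifT => //.
  by apply: measurable_fun_ler => //; exact: measurable_enorm.
apply: measurable_funM => //.
by apply: (measurableT_comp (measurable_powR _)); exact: measurable_enorm.
Qed.

Lemma measurable_heat_kernel (t : R) :
  measurable_fun setT
    (fun z : euclid R N * euclid R N => heat_kernel t (esub z.1 z.2)).
Proof.
rewrite /heat_kernel; apply: measurable_funM => //.
apply: (measurableT_comp (@measurable_expR R)).
apply: measurableT_comp => //; apply: measurable_funM => //.
by apply: measurable_funX; exact: measurable_enorm_esub.
Qed.

Lemma heat_kernel_ge0 (t : R) x : 0 <= heat_kernel t x.
Proof. by rewrite mulr_ge0 ?powR_ge0 ?expR_ge0. Qed.

Let measurable_heat_integrand (t : R) (u : euclid R N -> R) :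
  measurable_fun setT u ->
  measurable_fun setT (fun z : euclid R N * euclid R N =>
    (heat_kernel t (esub z.1 z.2) * u z.2)%:E).
Proof.
move=> mu; apply/measurable_EFinP/measurable_funM.
  exact: measurable_heat_kernel.
exact: measurableT_comp mu measurable_snd.
Qed.

(** The integral may diverge, so the positive and negative parts of the integrand are treated
    separately by Tonelli's theorem and subtracted as extended reals. *)
Lemma measurable_heat_semigroup (t : R) (u : euclid R N -> R) :
  measurable_fun setT u -> measurable_fun setT (heat_semigroup t u).
Proof.
move=> /(measurable_heat_integrand t); set h := (X in measurable_fun _ X) => mh.
rewrite (_ : heat_semigroup t u = fun x =>
  fubini_F (lebesgueN R N) h^\+%E x - fubini_F (lebesgueN R N) h^\-%E x)%E; last first.
  apply/funext => x; rewrite /heat_semigroup integralE /fubini_F.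
  by congr (_ - _)%E; apply: eq_integral => y _; rewrite ?funeposE ?funenegE.
apply: emeasurable_funB.
- exact: (measurable_fun_fubini_tonelli_F _ (measurable_funepos mh) (funepos_ge0 h)).
- exact: (measurable_fun_fubini_tonelli_F _ (measurable_funeneg mh) (funeneg_ge0 h)).
Qed.

Lemma weighted_heat_semigroup_le (g mu : R) : (0 < N)%N -> 0 <= g <= mu ->
  exists2 C, 0 < C & forall (rho : R) (u : euclid R N -> R) x,
    0 < rho -> measurable_fun setT (fun y => enorm y `^ mu * u y) ->
    (`|(enorm x `^ g)%:E * heat_semigroup (rho ^+ 2) u x| <=
     (C * rho `^ (- (mu - g) - N%:R))%:E *
     (kernel_op (lebesgueN R N) (decay rho)
        (near_weight mu rho \* (fun y => `|enorm y `^ mu * u y|))%R x +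
      kernel_op (lebesgueN R N) (decay rho)
        (far_weight (mu - g) rho \* (fun y => `|enorm y `^ mu * u y|))%R x))%E.
Proof.
move=> N0 gmu; have [C C0 CP] := @weighted_heat_kernel_le R N g mu gmu.
exists C => // rho u x rho0 mh; set f := fun y => `|enorm y `^ mu * u y|.
have mu' := measurable_of_weighted mh.
have mf : measurable_fun setT f by exact: measurableT_comp.
have f0 y : 0 <= f y by exact: normr_ge0.
have mG : measurable_fun setT
    (fun y => (heat_kernel (rho ^+ 2) (esub x y) * u y)%:E).
  exact: measurableT_comp (measurable_heat_integrand _ mu') (measurable_pair1 x).
have mdw (w : euclid R N -> R) : measurable_fun setT w ->
    measurable_fun setT (fun y => (decay rho (x, y) * (w \* f)%R y)%:E).
  move=> mw; apply/measurable_EFinP/measurable_funM; last exact: measurable_funM.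
  exact: measurableT_comp (measurable_decay rho) (measurable_pair1 x).
have mn := mdw _ (measurable_near_weight mu rho).
have mfar := mdw _ (measurable_far_weight (mu - g) rho).
have d0 y : 0 <= decay rho (x, y) by case/andP: (decay01 rho (x, y)).
have n0 y : (0 <= (decay rho (x, y) * (near_weight mu rho \* f)%R y)%:E)%E.
  by rewrite lee_fin !mulr_ge0 ?near_weight_ge0.
have far0 y : (0 <= (decay rho (x, y) * (far_weight (mu - g) rho \* f)%R y)%:E)%E.
  by rewrite lee_fin !mulr_ge0 ?far_weight_ge0.
rewrite abseM gee0_abs ?lee_fin ?powR_ge0//.
apply: le_trans (lee_wpmul2l _ (le_abse_integral _ _ mG)) _ => //.
  by rewrite lee_fin powR_ge0.
rewrite -ge0_integralZl_EFin ?powR_ge0//; last exact: measurableT_comp.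
rewrite /kernel_op -ge0_integralD//.
have c0 : 0 <= C * rho `^ (- (mu - g) - N%:R) by rewrite mulr_ge0 ?powR_ge0// ltW.
rewrite -ge0_integralZl_EFin//; last 2 first.
- by move=> y _; exact: adde_ge0.
- exact: emeasurable_funD.
apply: ae_ge0_le_integral => //.
- by move=> y _; rewrite mule_ge0 ?lee_fin ?powR_ge0.
- by apply: measurable_funeM; exact: measurableT_comp.
- by move=> y _; apply: mule_ge0; [rewrite lee_fin|exact: adde_ge0].
- by apply: measurable_funeM; exact: emeasurable_funD.
- (* at y = 0 the right-hand side may vanish although u y does not *)
  apply: filterS (ae_enorm_gt0 N0) => y y0 _.
  rewrite /= lee_fin normrM (ger0_norm (heat_kernel_ge0 _ _)) mulrA.
  exact: CP.
Qed.

End heat_semigroup_bound.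

(** * The weighted smoothing estimate *)

Unset Implicit Arguments.
Set Strict Implicit.
Set Printing Implicit Defensive.

Theorem proposition3p1 (R : realType) (N : nat) (gamma mu : R)
    (q1 q2 : \bar R)
    (N_ge1 : (1 <= N)%N)
    (gamma_mu : 0 <= gamma <= mu) (mu_N : mu < N%:R)
    (q1_gt1 : (1 < q1)%E) (q2_gt1 : (1 < q2)%E)
    (q2_lt : 0 <= inv_exponent q2 < (mu - gamma) / N%:R + inv_exponent q1)
    (q1_lt : (mu - gamma) / N%:R + inv_exponent q1
               <= mu / N%:R + inv_exponent q1 < 1) :
  exists C : R, 0 < C /\
    forall (t : R) (u : euclid R N -> R), 0 < t ->
      (fun x => enorm x `^ mu * u x) \in Lfun (lebesgueN R N) q1 ->
      ('N[lebesgueN R N]_q2 [(fun x => (enorm x `^ gamma)%:E * heat_semigroup t u x)]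
       <= (C * t `^ (- (N%:R / 2) * (inv_exponent q1 - inv_exponent q2)
                     - (mu - gamma) / 2))%:E
          * 'N[lebesgueN R N]_q1 [(fun x => (enorm x `^ mu * u x)%:E)])%E.
Proof.
have /andP[g0 gmu] := gamma_mu; have mu0 : 0 <= mu by exact: le_trans gmu.
have N0 : 0 < N%:R :> R by rewrite ltr0n.
have /andP[_ q2_lt'] := q2_lt; have /andP[_ q1_lt'] := q1_lt.
set i1 := inv_exponent q1 in q2_lt' q1_lt' *; set i2 := inv_exponent q2 in q2_lt' *.
have muN0 : 0 <= mu / N%:R by rewrite divr_ge0// ltW.
have i1_lt1 : i1 < 1 by lra.
(* [near_cond] is [mu/N + 1/q1 < 1], and [far_cond] is [1/q2 < (mu - gamma)/N + 1/q1], both cleared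
   of denominators. *)
have near_cond : mu < N%:R * (1 - i1) by rewrite mulrC -ltr_pdivrMr//; lra.
have far_cond : N%:R * (i2 - i1) < mu - gamma by rewrite mulrC -ltr_pdivlMr//; lra.
have a0 : 0 <= mu - gamma by rewrite subr_ge0.
have [Cn Cn0 CnP] := near_smoothing mu0 q1_gt1 q2_gt1 i1_lt1 near_cond.
have [Cf Cf0 CfP] := far_smoothing a0 q1_gt1 q2_gt1 far_cond.
have [K K0 KP] := @weighted_heat_semigroup_le R N gamma mu N_ge1 gamma_mu.
exists (K * (Cn + Cf)); split; first by rewrite mulr_gt0// addr_gt0.
move=> t u t0 /andP[]; rewrite !inE/= => mh; rewrite /finite_norm => hoo.
set h := fun x => enorm x `^ mu * u x in mh hoo.
set M : R := fine ('N[lebesgueN R N]_q1 [EFin \o h]).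
have M0 : 0 <= M by rewrite fine_ge0// Lnorm_ge0.
have hM : ('N[lebesgueN R N]_q1 [EFin \o h] = M%:E)%E.
  by rewrite fineK// ge0_fin_numE ?Lnorm_ge0.
have mf : measurable_fun setT (fun x => `|h x|) by exact: measurableT_comp.
have fM : ('N[lebesgueN R N]_q1 [EFin \o (fun x => `|h x|)%R] <= M%:E)%E.
  by rewrite -hM -[leRHS]Lnorm_abse.
pose rho := Num.sqrt t.
have rho0 : 0 < rho by rewrite sqrtr_gt0.
have tE : t = rho ^+ 2 by rewrite sqr_sqrtr// ltW.
have f0 x : 0 <= `|h x| by exact: normr_ge0.
have [Fn_oo FnM] := CnP rho M _ rho0 M0 mf f0 fM.
have [Ff_oo FfM] := CfP rho M _ rho0 M0 mf f0 fM.
set Fn := kernel_op _ _ _ in Fn_oo FnM; set Ff := kernel_op _ _ _ in Ff_oo FfM.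
have mFn : measurable_fun setT Fn.
  apply: measurable_kernel_op.
  - exact: measurable_decay.
  - exact: decay01.
  - by apply: measurable_funM => //; exact: measurable_near_weight.
  - by move=> y; rewrite mulr_ge0 ?near_weight_ge0.
have mFf : measurable_fun setT Ff.
  apply: measurable_kernel_op.
  - exact: measurable_decay.
  - exact: decay01.
  - by apply: measurable_funM => //; exact: measurable_far_weight.
  - by move=> y; rewrite mulr_ge0 ?far_weight_ge0.
have Fn0 x : (0 <= Fn x)%E.
  apply: kernel_op_ge0; first exact: decay01.
  by move=> y; rewrite mulr_ge0 ?near_weight_ge0.
have Ff0 x : (0 <= Ff x)%E.
  apply: kernel_op_ge0; first exact: decay01.
  by move=> y; rewrite mulr_ge0 ?far_weight_ge0.
(* Pointwise finiteness turns [Fn] and [Ff] into real functions, to which [eminkowski] applies. *)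
have FnE : Fn = EFin \o (fine \o Fn).
  by apply/funext => x /=; rewrite fineK// ge0_fin_numE.
have FfE : Ff = EFin \o (fine \o Ff).
  by apply/funext => x /=; rewrite fineK// ge0_fin_numE.
have mfn : measurable_fun setT (fine \o Fn) by exact: measurableT_comp.
have mff : measurable_fun setT (fine \o Ff) by exact: measurableT_comp.
set E := rho `^ (N%:R * (1 + i2 - i1)) in FnM FfM.
have sumM : ('N[lebesgueN R N]_q2 [EFin \o ((fine \o Fn) \+ (fine \o Ff))%R] <=
    ((Cn + Cf) * E * M)%:E)%E.
  apply: le_trans (eminkowski _ mfn mff (ltW q2_gt1)) _.
  by rewrite -FnE -FfE !mulrDl EFinD leeD.
rewrite [X in (_ * X)%E]hM -EFinM.
have -> : K * (Cn + Cf) * t `^ (- (N%:R / 2) * (i1 - i2) - (mu - gamma) / 2) * M =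
    K * rho `^ (- (mu - gamma) - N%:R) * ((Cn + Cf) * E * M).
  (* As [t = rho^2], the exponent of [t] is doubled, and [- (mu - gamma) - N + N (1 + 1/q2 - 1/q1)]
     equals [- N (1/q1 - 1/q2) - (mu - gamma)]. *)
  have -> : t `^ (- (N%:R / 2) * (i1 - i2) - (mu - gamma) / 2) =
      rho `^ (- (mu - gamma) - N%:R) * E.
    rewrite /E -powRD ?(gt_eqF rho0) ?implybT// tE -powR_mulrn ?(ltW rho0)// -powRrM.
    by congr (_ `^ _); field.
  by ring.
apply: Lnorm_le_scale sumM.
- apply: emeasurable_funM.
    apply/measurable_EFinP/(measurableT_comp (measurable_powR _)).
    exact: measurable_enorm.
  by apply: measurable_heat_semigroup; exact: measurable_of_weighted mh.
- by apply/measurable_EFinP; exact: measurable_funD.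
- exact: lt_trans q2_gt1.
- by rewrite mulr_ge0 ?powR_ge0// ltW.
- by rewrite !mulr_ge0 ?powR_ge0// addr_ge0// ltW.
- move=> x; rewrite tE; apply: le_trans (KP rho u x rho0 mh) _.
  rewrite -/Fn -/Ff /= ger0_norm ?addr_ge0 ?fine_ge0//.
  by rewrite EFinD !fineK ?ge0_fin_numE.
Qed.
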